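(* Let $q>1$ be an integer and define the entire function $$\xi_q(s)=(q-1)^s\bigl(2(q+1)\zeta_q(s)-\zeta_q(s-1)\bigr),\qquad s\in\mathbb C.$$ Then, for all $s\in\mathbb C$, $$\xi_q(1-s)=\xi_q(s).$$
   Context: For an integer $q\ge 2$, let $T_{q+1}$ be the regular tree of degree $q+1$, with adjacency operator $A$, combinatorial Laplacian $\Delta_q=(q+1)-A$ acting on $\ell^2(T_{q+1})$, and a fixed vertex $\mathbf 0$. The spectral zeta function of $T_{q+1}$ is the entire function $$\zeta_q(s)=\langle \Delta_q^{-s}\delta_{\mathbf 0}\mid\delta_{\mathbf 0}\rangle=\frac{q+1}{2\pi}\int_{-2\sqrt q}^{2\sqrt q}(q+1-\lambda)^{-s}\,\frac{\sqrt{4q-\lambda^2}}{(q+1)^2-\lambda^2}\,\mathrm d\lambda ,\qquad s\in\mathbb C.$$ Powers of positive reals are taken with the real logarithm, e.g. $(q-1)^s=e^{s\log(q-1)}$. *)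

(* Defs.v *)
From Stdlib Require Import Reals Lra Lia.
From Coquelicot Require Import Coquelicot.

Open Scope R_scope.

Definition Cexp (z : C) : C :=
  Cmult (RtoC (exp (Re z))) (cos (Im z), sin (Im z)).

(* Only meaningful for [0 < t]: [ln t = 0] by convention otherwise. *)
Definition cpow (t : R) (s : C) : C := Cexp (Cmult s (RtoC (ln t))).

(* Integration by [RInt] with values in [C], seen as a Banach space over [R].
   Up to the constant [(q + 1) / (2 * PI)], this is the integral against the
   spectral (Kesten-McKay) measure of the (q+1)-regular tree at a vertex. *)
Definition zeta_integrand (q : nat) (s : C) (l : R) : C :=
  Cmult (cpow (INR q + 1 - l) (Copp s))
        (RtoC (sqrt (4 * INR q - l ^ 2) / ((INR q + 1) ^ 2 - l ^ 2))).

Definition tree_zeta (q : nat) (s : C) : C :=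
  Cmult (RtoC ((INR q + 1) / (2 * PI)))
        (RInt (V := C_R_CompleteNormedModule) (zeta_integrand q s)
              (- (2 * sqrt (INR q))) (2 * sqrt (INR q))).

Definition tree_xi (q : nat) (s : C) : C :=
  Cmult (cpow (INR q - 1) s)
        (Cminus (Cmult (RtoC (2 * (INR q + 1))) (tree_zeta q s))
                (tree_zeta q (Cminus s (RtoC 1)))).

(* [RInt] is a total operator; this shows that it is applied above to an
   integrable function. *)
Lemma ex_RInt_zeta_integrand (q : nat) (s : C) :
  (1 < q)%nat ->
  ex_RInt (V := C_R_CompleteNormedModule) (zeta_integrand q s)
          (- (2 * sqrt (INR q))) (2 * sqrt (INR q)).
Proof.
intros hq.
assert (hQ : 2 <= INR q) by (apply (le_INR 2); lia).
assert (hs : sqrt (INR q) * sqrt (INR q) = INR q) by (apply sqrt_sqrt; lra).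
assert (hs0 : 0 <= sqrt (INR q)) by apply sqrt_pos.
assert (hb : 2 * sqrt (INR q) < INR q + 1) by nra.
set (w := fun l => sqrt (4 * INR q - l ^ 2) / ((INR q + 1) ^ 2 - l ^ 2)).
set (g := fun l => ln (INR q + 1 - l)).
assert (main : forall l, - (2 * sqrt (INR q)) <= l <= 2 * sqrt (INR q) ->
          continuous g l /\ continuous w l).
{ intros l hl; split.
  - apply continuity_pt_filterlim, derivable_continuous_pt.
    exists (- / (INR q + 1 - l)); apply is_derive_Reals; unfold g.
    auto_derive; [lra | field; lra].
  - apply (continuous_mult (fun l => sqrt (4 * INR q - l ^ 2))
             (fun l => / ((INR q + 1) ^ 2 - l ^ 2))).
    + apply (continuous_comp (fun l => 4 * INR q - l ^ 2) sqrt).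
      * apply @ex_derive_continuous; auto_derive; exact I.
      * apply continuous_sqrt.
    + apply @ex_derive_continuous; auto_derive; nra. }
set (fr := fun l => exp (- Re s * g l) * cos (- Im s * g l) * w l).
set (fi := fun l => exp (- Re s * g l) * sin (- Im s * g l) * w l).
assert (E : forall l, zeta_integrand q s l = (fr l, fi l)).
{ intros l; unfold zeta_integrand, cpow, Cexp, fr, fi, w, g.
  destruct s as [x y]; unfold Cmult, Copp, RtoC, Re, Im; cbn [fst snd].
  rewrite ?Rmult_0_r, ?Rmult_0_l, ?Rminus_0_r, ?Rplus_0_l, ?Rplus_0_r.
  f_equal; ring. }
assert (lin : forall a l, continuous g l -> continuous (fun l => a * g l) l).
{ intros a l h; apply (continuous_mult (fun _ => a) g);
    [apply continuous_const | exact h]. }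
apply (ex_RInt_ext (V := C_R_CompleteNormedModule) (fun l => (fr l, fi l))).
{ intros l _; symmetry; apply E. }
apply (ex_RInt_fct_extend_pair (U := R_NormedModule) (V := R_NormedModule)
         (fun l => (fr l, fi l))).
- apply (ex_RInt_continuous (V := R_CompleteNormedModule)).
  intros l hl; rewrite Rmin_left, Rmax_right in hl by lra.
  destruct (main l hl) as [hg hw].
  apply (continuous_mult (fun l => exp (- Re s * g l) * cos (- Im s * g l)) w);
    [|exact hw].
  apply (continuous_mult (fun l => exp (- Re s * g l)) (fun l => cos (- Im s * g l))).
  + apply (continuous_comp (fun l => - Re s * g l) exp);
      [apply lin, hg | apply continuous_exp].
  + apply (continuous_comp (fun l => - Im s * g l) cos);
      [apply lin, hg | apply continuous_cos].
- apply (ex_RInt_continuous (V := R_CompleteNormedModule)).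
  intros l hl; rewrite Rmin_left, Rmax_right in hl by lra.
  destruct (main l hl) as [hg hw].
  apply (continuous_mult (fun l => exp (- Re s * g l) * sin (- Im s * g l)) w);
    [|exact hw].
  apply (continuous_mult (fun l => exp (- Re s * g l)) (fun l => sin (- Im s * g l))).
  + apply (continuous_comp (fun l => - Re s * g l) exp);
      [apply lin, hg | apply continuous_exp].
  + apply (continuous_comp (fun l => - Im s * g l) sin);
      [apply lin, hg | apply continuous_sin].
Qed.

(* Main.v *)
Require Import Defs.
From Stdlib Require Import Reals Lra.
From Coquelicot Require Import Coquelicot.

(** Why the functional equation holds.  Write [x = q + 1 - l] for the spectral
    variable of the Laplacian.  It ranges over [[a, b]], where
    [a = (sqrt q - 1)^2] and [b = (sqrt q + 1)^2] satisfy [a + b = 2 (q + 1)]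
    and [a b = (q - 1)^2].  The spectral density is, up to a constant,
    [sqrt ((x - a) (b - x)) / (x (a + b - x))], so the combination
    [2 (q + 1) zeta(s) - zeta(s - 1)] inserts a factor [a + b - x] in the
    integral of [x^(-s)] and cancels the pole of the density outside the
    spectrum.  What remains is the Mellin-type integral
    [J(s) = int_a^b x^(-s-1) sqrt ((x - a) (b - x)) dx]
    ([tree_xi_spectral_integral]).

    The inversion [x -> a b / x] exchanges the end points [a] and [b] and maps
    [sqrt ((x - a) (b - x))] to [sqrt (a b) / x] times itself.  Hence
    [J(s) = (q - 1)^(1 - 2 s) J(1 - s)] ([spectral_integral_reflection]), and
    the factor [(q - 1)^s] makes this relation symmetric. *)

Open Scope R_scope.

(** * Complex powers of positive reals *)

Lemma Cexp_plus (z w : C) : Cexp (Cplus z w) = Cmult (Cexp z) (Cexp w).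
Proof.
destruct z as [a b], w as [c d].
unfold Cexp, Cmult, Cplus, RtoC, Re, Im; cbn [fst snd].
rewrite exp_plus, cos_plus, sin_plus; f_equal; ring.
Qed.

Lemma cpow_plus (t : R) (z w : C) :
  cpow t (Cplus z w) = Cmult (cpow t z) (cpow t w).
Proof. unfold cpow; rewrite <- Cexp_plus; f_equal; ring. Qed.

Lemma cpow_1 (t : R) : 0 < t -> cpow t (RtoC 1) = RtoC t.
Proof.
intros ht; unfold cpow, Cexp, Cmult, RtoC, Re, Im; cbn [fst snd].
replace (1 * 0 + 0 * ln t) with 0 by ring.
replace (1 * ln t - 0 * 0) with (ln t) by ring.
rewrite exp_ln, cos_0, sin_0 by exact ht; f_equal; ring.
Qed.

Lemma cpow_mult_base (t u : R) (z : C) :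
  0 < t -> 0 < u -> cpow (t * u) z = Cmult (cpow t z) (cpow u z).
Proof.
intros ht hu; unfold cpow; rewrite <- Cexp_plus, ln_mult, RtoC_plus by assumption.
f_equal; ring.
Qed.

Lemma cpow_inv_base (t : R) (z : C) : 0 < t -> cpow (/ t) z = cpow t (Copp z).
Proof.
intros ht; unfold cpow; rewrite ln_Rinv, RtoC_opp by exact ht; f_equal; ring.
Qed.

Lemma continuous_cpow (z : C) (t : R) :
  0 < t ->
  continuous (T := R_UniformSpace) (U := C_R_NormedModule) (fun u => cpow u z) t.
Proof.
intros ht; destruct z as [x y].
apply (continuous_ext (T := R_UniformSpace) (U := C_R_NormedModule)
  (fun u => (exp (x * ln u) * cos (y * ln u), exp (x * ln u) * sin (y * ln u)))).
{ intros u; unfold cpow, Cexp, Cmult, RtoC, Re, Im; cbn [fst snd].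
  replace (x * ln u - y * 0) with (x * ln u) by ring.
  replace (x * 0 + y * ln u) with (y * ln u) by ring.
  f_equal; ring. }
apply (continuous_comp_2 (U := R_UniformSpace) (V := R_UniformSpace)
  (W := R_UniformSpace) (X := C_R_NormedModule)
  (fun u => exp (x * ln u) * cos (y * ln u))
  (fun u => exp (x * ln u) * sin (y * ln u)) (fun u v => (u, v))).
- apply @ex_derive_continuous; auto_derive; repeat split; exact ht.
- apply @ex_derive_continuous; auto_derive; repeat split; exact ht.
- apply (continuous_ext (fun p : R * R => p)); [intros []; reflexivity|].
  apply continuous_id.
Qed.

(** * Integrals with values in the complex numbers *)

(** [RInt] treats [C] as a real normed module, so that only real constants
    come out of it by linearity; for a complex constant the real and imaginary
    parts have to be recombined. *)
Lemma RInt_Cmult (f : R -> C) (a b : R) (c : C) :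
  ex_RInt (V := C_R_CompleteNormedModule) f a b ->
  RInt (V := C_R_CompleteNormedModule) (fun x => Cmult c (f x)) a b
  = Cmult c (RInt (V := C_R_CompleteNormedModule) f a b).
Proof.
intros hf; apply is_RInt_unique.
pose proof (RInt_correct _ _ _ hf) as h.
set (I := RInt _ a b) in *.
pose proof (is_RInt_fct_extend_fst (U := R_NormedModule) (V := R_NormedModule) f a b I h) as h1.
pose proof (is_RInt_fct_extend_snd (U := R_NormedModule) (V := R_NormedModule) f a b I h) as h2.
destruct c as [u v].
apply (is_RInt_fct_extend_pair (U := R_NormedModule) (V := R_NormedModule)
         (fun x => Cmult (u, v) (f x)) a b
         (u * fst I - v * snd I) (u * snd I + v * fst I)).
- apply (is_RInt_minus (V := R_NormedModule) (fun x => u * fst (f x)) (fun x => v * snd (f x)));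
    apply (is_RInt_scal (V := R_NormedModule)); assumption.
- apply (is_RInt_plus (V := R_NormedModule) (fun x => u * snd (f x)) (fun x => v * fst (f x)));
    apply (is_RInt_scal (V := R_NormedModule)); assumption.
Qed.

(** * The spectral integral and its symmetry *)

(** In the variable [x = q + 1 - l] this is
    [x^(-s-1) sqrt ((x - a) (b - x))]. *)
Definition spectral_integrand (Q : R) (s : C) (l : R) : C :=
  Cmult (cpow (Q + 1 - l) (Copp s)) (RtoC (sqrt (4 * Q - l ^ 2) / (Q + 1 - l))).

Definition spectral_integral (Q : R) (s : C) : C :=
  RInt (V := C_R_CompleteNormedModule) (spectral_integrand Q s)
       (- (2 * sqrt Q)) (2 * sqrt Q).

(** The spectral gap [a = (sqrt Q - 1)^2 > 0]: it keeps [x] positive on the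
    whole interval of integration. *)
Lemma spectral_edge (Q : R) : 1 < Q -> 2 * sqrt Q < Q + 1.
Proof.
intros hQ; pose proof (sqrt_sqrt Q ltac:(lra)); pose proof (sqrt_pos Q).
assert (sqrt Q <> 1) by (intros e; rewrite e in *; lra).
assert (0 < (sqrt Q - 1) ^ 2) by (apply pow2_gt_0; lra).
lra.
Qed.

Lemma continuous_spectral_integrand (Q : R) (s : C) (l : R) :
  l < Q + 1 ->
  continuous (T := R_UniformSpace) (U := C_R_NormedModule)
    (spectral_integrand Q s) l.
Proof.
intros hl.
apply (continuous_ext (T := R_UniformSpace) (U := C_R_NormedModule)
  (fun t => scal (V := C_R_NormedModule) (sqrt (4 * Q - t ^ 2) / (Q + 1 - t))
              (cpow (Q + 1 - t) (Copp s)))).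
{ intros t; rewrite scal_R_Cmult; apply Cmult_comm. }
apply (continuous_scal (V := C_R_NormedModule)).
- apply (continuous_mult (fun t => sqrt (4 * Q - t ^ 2)) (fun t => / (Q + 1 - t))).
  + apply (continuous_comp (fun t => 4 * Q - t ^ 2) sqrt).
    * apply @ex_derive_continuous; auto_derive; exact I.
    * apply continuous_sqrt.
  + apply @ex_derive_continuous; auto_derive; lra.
- apply (continuous_comp (U := R_UniformSpace) (V := R_UniformSpace)
           (W := C_R_NormedModule) (fun t => Q + 1 - t) (fun u => cpow u (Copp s))).
  + apply @ex_derive_continuous; auto_derive; exact I.
  + apply continuous_cpow; lra.
Qed.

Lemma ex_RInt_spectral_integrand (Q : R) (s : C) :
  1 < Q ->
  ex_RInt (V := C_R_CompleteNormedModule) (spectral_integrand Q s)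
    (- (2 * sqrt Q)) (2 * sqrt Q).
Proof.
intros hQ; pose proof (spectral_edge Q hQ); pose proof (sqrt_pos Q).
apply (ex_RInt_continuous (V := C_R_CompleteNormedModule)).
intros l hl; rewrite Rmin_left, Rmax_right in hl by lra.
apply continuous_spectral_integrand; lra.
Qed.

(** The inversion [x -> a b / x], written in the variable [l]. *)
Definition spectral_inversion (Q l : R) : R := Q + 1 - (Q - 1) ^ 2 / (Q + 1 - l).

Lemma spectral_inversion_left (Q : R) :
  1 < Q -> spectral_inversion Q (- (2 * sqrt Q)) = 2 * sqrt Q.
Proof.
intros hQ; pose proof (sqrt_pos Q).
unfold spectral_inversion.
replace ((Q - 1) ^ 2) with ((Q + 1 - 2 * sqrt Q) * (Q + 1 - - (2 * sqrt Q)))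
  by (ring_simplify; rewrite <- (Rsqr_pow2 (sqrt Q)), Rsqr_sqrt by lra; ring).
field; lra.
Qed.

Lemma spectral_inversion_right (Q : R) :
  1 < Q -> spectral_inversion Q (2 * sqrt Q) = - (2 * sqrt Q).
Proof.
intros hQ; pose proof (spectral_edge Q hQ).
unfold spectral_inversion.
replace ((Q - 1) ^ 2) with ((Q + 1 - 2 * sqrt Q) * (Q + 1 + 2 * sqrt Q))
  by (ring_simplify; rewrite <- (Rsqr_pow2 (sqrt Q)), Rsqr_sqrt by lra; ring).
field; lra.
Qed.

(** With [x = Q + 1 - l], the radicand is [- x^2 + 2 (Q + 1) x - (Q - 1)^2]; the
    inversion [x -> (Q - 1)^2 / x] multiplies the middle term by
    [((Q - 1) / x)^2] and exchanges the outer two up to the same factor. *)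
Lemma sqrt_spectral_inversion (Q l : R) :
  1 < Q -> l < Q + 1 ->
  sqrt (4 * Q - spectral_inversion Q l ^ 2)
  = (Q - 1) / (Q + 1 - l) * sqrt (4 * Q - l ^ 2).
Proof.
intros hQ hl.
assert (hp : 0 <= (Q - 1) / (Q + 1 - l))
  by (apply Rlt_le, Rdiv_lt_0_compat; lra).
rewrite <- (sqrt_pow2 _ hp) at 1.
rewrite <- sqrt_mult_alt by apply pow2_ge_0.
f_equal; unfold spectral_inversion; field; lra.
Qed.

Lemma spectral_integrand_inversion (Q : R) (s : C) (l : R) :
  1 < Q -> l < Q + 1 ->
  Cmult (RtoC (- ((Q - 1) ^ 2 / (Q + 1 - l) ^ 2)))
        (spectral_integrand Q s (spectral_inversion Q l))
  = Cmult (Copp (cpow (Q - 1) (Cminus (RtoC 1) (Cmult (RtoC 2) s))))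
          (spectral_integrand Q (Cminus (RtoC 1) s) l).
Proof.
intros hQ hl; unfold spectral_integrand.
rewrite sqrt_spectral_inversion by assumption.
replace (Q + 1 - spectral_inversion Q l)
  with ((Q - 1) * (Q - 1) * / (Q + 1 - l))
  by (unfold spectral_inversion; field; lra).
set (p := Q - 1); set (x := Q + 1 - l); set (r := sqrt _).
assert (hp : 0 < p) by (unfold p; lra).
assert (hx : 0 < x) by (unfold x; lra).
rewrite !cpow_mult_base, cpow_inv_base
  by (try apply Rmult_lt_0_compat; try apply Rinv_0_lt_compat; assumption).
replace (Cminus (RtoC 1) (Cmult (RtoC 2) s))
  with (Cplus (RtoC 1) (Cplus (Copp s) (Copp s))) by ring.
rewrite !cpow_plus, cpow_1 by exact hp.
(* [s = (s - 1) + 1] produces the missing factor [x]. *)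
replace (Copp (Copp s)) with (Cplus (Copp (Cminus (RtoC 1) s)) (RtoC 1)) by ring.
rewrite cpow_plus, cpow_1 by exact hx.
set (P := cpow p _); set (X := cpow x _).
assert (e : Cmult (RtoC (- (p ^ 2 / x ^ 2)))
              (Cmult (RtoC x) (RtoC (p / x * r / (p * p * / x))))
            = Copp (Cmult (RtoC p) (RtoC (r / x)))).
{ rewrite <- !RtoC_mult, <- RtoC_opp; f_equal; field; lra. }
transitivity (Cmult (Cmult (Cmult P P) X)
  (Cmult (RtoC (- (p ^ 2 / x ^ 2)))
     (Cmult (RtoC x) (RtoC (p / x * r / (p * p * / x)))))); [ring|].
rewrite e; ring.
Qed.

Lemma spectral_integral_reflection (Q : R) (s : C) :
  1 < Q ->
  spectral_integral Q s
  = Cmult (cpow (Q - 1) (Cminus (RtoC 1) (Cmult (RtoC 2) s)))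
          (spectral_integral Q (Cminus (RtoC 1) s)).
Proof.
intros hQ; pose proof (spectral_edge Q hQ) as he; pose proof (sqrt_pos Q) as h0.
pose proof (RInt_comp (V := C_R_CompleteNormedModule) (spectral_integrand Q s)
  (spectral_inversion Q) (fun l => - ((Q - 1) ^ 2 / (Q + 1 - l) ^ 2))
  (- (2 * sqrt Q)) (2 * sqrt Q)) as hsub.
rewrite Rmin_left, Rmax_right, spectral_inversion_left,
  spectral_inversion_right in hsub by lra.
(* The inversion reverses the orientation of the interval. *)
unfold spectral_integral at 1.
rewrite <- (opp_RInt_swap (V := C_R_CompleteNormedModule)), <- hsub.
- rewrite (RInt_ext (V := C_R_CompleteNormedModule) _
    (fun l => Cmult (Copp (cpow (Q - 1) (Cminus (RtoC 1) (Cmult (RtoC 2) s))))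
                    (spectral_integrand Q (Cminus (RtoC 1) s) l))).
  + rewrite RInt_Cmult by (apply ex_RInt_spectral_integrand; exact hQ).
    fold (spectral_integral Q (Cminus (RtoC 1) s)).
    change (@opp _) with Copp; ring.
  + intros l hl; rewrite Rmin_left, Rmax_right in hl by lra.
    rewrite scal_R_Cmult; apply spectral_integrand_inversion; lra.
- intros l hl; apply continuous_spectral_integrand; unfold spectral_inversion.
  assert (0 < (Q - 1) ^ 2 / (Q + 1 - l))
    by (apply Rdiv_lt_0_compat; [apply pow2_gt_0|]; lra).
  lra.
- intros l hl; split.
  + unfold spectral_inversion; auto_derive; [lra | field; lra].
  + apply @ex_derive_continuous; auto_derive.
    apply Rmult_integral_contrapositive; split; lra.
- apply ex_RInt_swap, ex_RInt_spectral_integrand; exact hQ.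
Qed.

(** * From the zeta function to the spectral integral *)

(** [x (2 (q + 1) - x) = (q + 1)^2 - l^2], so [2 (q + 1) - x] cancels against
    the denominator of the spectral density. *)
Lemma zeta_integrand_combination (q : nat) (s : C) (l : R) :
  - (INR q + 1) < l < INR q + 1 ->
  Cminus (Cmult (RtoC (2 * (INR q + 1))) (zeta_integrand q s l))
         (zeta_integrand q (Cminus s (RtoC 1)) l)
  = spectral_integrand (INR q) s l.
Proof.
intros hl; unfold zeta_integrand, spectral_integrand.
replace (Copp (Cminus s (RtoC 1))) with (Cplus (Copp s) (RtoC 1)) by ring.
rewrite cpow_plus, cpow_1 by lra.
set (X := cpow _ _); set (r := sqrt _).
replace (r / (INR q + 1 - l)) with
  (2 * (INR q + 1) * (r / ((INR q + 1) ^ 2 - l ^ 2))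
   - (INR q + 1 - l) * (r / ((INR q + 1) ^ 2 - l ^ 2))).
- set (w := r / _).
  rewrite (RtoC_minus (_ * w)), !(RtoC_mult _ w); ring.
- field; split; [lra|].
  replace ((INR q + 1) ^ 2 - l ^ 2)
    with ((INR q + 1 - l) * (INR q + 1 + l)) by ring.
  apply Rmult_integral_contrapositive; split; lra.
Qed.

Lemma tree_xi_spectral_integral (q : nat) (s : C) :
  (1 < q)%nat ->
  tree_xi q s
  = Cmult (cpow (INR q - 1) s)
      (Cmult (RtoC ((INR q + 1) / (2 * PI))) (spectral_integral (INR q) s)).
Proof.
intros hq.
assert (hQ : 1 < INR q) by (apply (lt_INR 1); exact hq).
pose proof (spectral_edge _ hQ) as he; pose proof (sqrt_pos (INR q)) as h0.
unfold tree_xi, tree_zeta; f_equal.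
assert (e : spectral_integral (INR q) s
  = Cminus
      (Cmult (RtoC (2 * (INR q + 1)))
         (RInt (V := C_R_CompleteNormedModule) (zeta_integrand q s)
            (- (2 * sqrt (INR q))) (2 * sqrt (INR q))))
      (RInt (V := C_R_CompleteNormedModule) (zeta_integrand q (Cminus s (RtoC 1)))
            (- (2 * sqrt (INR q))) (2 * sqrt (INR q)))).
{ unfold spectral_integral.
  pose proof (ex_RInt_zeta_integrand q s hq) as h1.
  pose proof (ex_RInt_zeta_integrand q (Cminus s (RtoC 1)) hq) as h2.
  rewrite <- scal_R_Cmult, <- (RInt_scal (V := C_R_CompleteNormedModule)) by exact h1.
  change Cminus with (@minus C_R_CompleteNormedModule).
  rewrite <- (RInt_minus (V := C_R_CompleteNormedModule));
    [| apply (ex_RInt_scal (V := C_R_CompleteNormedModule)), h1 | exact h2].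
  apply (RInt_ext (V := C_R_CompleteNormedModule)).
  intros l hl; rewrite Rmin_left, Rmax_right in hl by lra.
  rewrite scal_R_Cmult; symmetry; apply zeta_integrand_combination; lra. }
rewrite e; ring.
Qed.

Theorem theorem1p3 (q : nat) (hq : (1 < q)%nat) (s : C) :
  tree_xi q (Cminus (RtoC 1) s) = tree_xi q s.
Proof.
assert (hQ : 1 < INR q) by (apply (lt_INR 1); exact hq).
rewrite !tree_xi_spectral_integral by exact hq.
rewrite (spectral_integral_reflection _ s hQ).
replace (Cminus (RtoC 1) s)
  with (Cplus s (Cminus (RtoC 1) (Cmult (RtoC 2) s))) at 1 by ring.
rewrite cpow_plus; ring.
Qed.
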